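(* Let $(M^n,g,f)$ be a closed generalized $(\lambda,n+m)$-Einstein manifold with $\min_M f<0<\max_M f$ (so $f^{-1}(0)\neq\emptyset$). Then there are no critical points of $f$ on the set $f^{-1}(0)$.
   Context: A closed generalized $(\lambda,n+m)$-Einstein manifold is a triple $(M^n,g,f)$ where $(M^n,g)$ is a closed (compact, connected, without boundary) Riemannian manifold of dimension $n$, $f$ is a smooth real function on $M$, and $Ddf=\frac{f}{m}(\mathrm{Ric}-\lambda g)$, where $Ddf$ is the Hessian of $f$, $\mathrm{Ric}$ is the Ricci tensor of $g$, $\lambda$ is a smooth function on $M$ and $m$ is a positive real number. *)

(* Defs.v *)
From HB Require Import structures.
From mathcomp Require Import all_boot all_order all_algebra.
From mathcomp Require Import all_classical all_reals all_analysis.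
Import Order.TTheory GRing.Theory Num.Theory.
Import numFieldNormedType.Exports.

Set Implicit Arguments.
Unset Strict Implicit.
Unset Printing Implicit Defensive.

Local Open Scope classical_set_scope.
Local Open Scope ring_scope.

Section Calculus.
Context {R : realType} {n : nat}.
Implicit Types (U : set 'rV[R]_n) (F : 'rV[R]_n -> R).

Definition partial (i : 'I_n) F : 'rV[R]_n -> R := 'D_(delta_mx 0 i) F.

(* Meant for an open U, so that pointwise continuity and derivability at the
   points of U depend on the restriction of F to U only. *)
Fixpoint class_C (k : nat) U F : Prop :=
  (forall x, U x -> {for x, continuous F}) /\
  if k is k'.+1 then
    forall i : 'I_n, (forall x, U x -> derivable F x (delta_mx 0 i)) /\
                     class_C k' U (partial i F)
  else True.

Definition smooth_on U F : Prop := forall k, class_C k U F.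

End Calculus.

Section Manifold.
Context {R : realType} {n : nat} {M : topologicalType}.

(* [chart_inv] is total; only its values on [chart_img] are meaningful.
   Domain and image are open (in M and in R^n: no boundary), so continuity at
   each of their points amounts to continuity for the subspace topologies. *)
Record chart := Chart {
  chart_dom : set M;
  chart_fun :> M -> 'rV[R]_n;
  chart_inv : 'rV[R]_n -> M;
  chart_dom_open : open chart_dom;
  chart_img_open : open (chart_fun @` chart_dom);
  chartK : forall p, chart_dom p -> chart_inv (chart_fun p) = p;
  chart_cont : forall p, chart_dom p -> {for p, continuous chart_fun};
  chart_inv_cont : forall x, (chart_fun @` chart_dom) x ->
    {for x, continuous chart_inv}
}.

Definition chart_img (c : chart) : set 'rV[R]_n := c @` chart_dom c.

Definition overlap (c c' : chart) : set 'rV[R]_n :=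
  c @` (chart_dom c `&` chart_dom c').

Definition transition (c c' : chart) (k : 'I_n) (x : 'rV[R]_n) : R :=
  c' (chart_inv c x) 0 k.

(* The atlas A need not be maximal. *)
Record smooth_manifold (A : set chart) : Prop := {
  manifold_hausdorff : hausdorff_space M;
  manifold_second_countable : @second_countable M;
  atlas_cover : forall p : M, exists2 c, A c & chart_dom c p;
  atlas_compat : forall c c', A c -> A c' ->
    forall k, smooth_on (overlap c c') (transition c c' k)
}.

Record closed_manifold (A : set chart) : Prop := {
  closed_smooth : smooth_manifold A;
  closed_compact : compact [set: M];
  closed_connected : connected [set: M]
}.

Definition smooth_function (A : set chart) (f : M -> R) : Prop :=
  forall c, A c -> smooth_on (chart_img c) (f \o chart_inv c).

(* df vanishes at p; by the chain rule, it does not matter in which chart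
   around p the partial derivatives are taken. *)
Definition critical_point (A : set chart) (f : M -> R) (p : M) : Prop :=
  exists c, [/\ A c, chart_dom c p &
    forall i, partial i (f \o chart_inv c) (c p) = 0].

(* A (0,2)-tensor field is given by its matrix of components in each chart. *)
Record tensor_field (A : set chart) (T : chart -> 'rV[R]_n -> 'M[R]_n) :
    Prop := {
  tensor_smooth : forall c, A c -> forall i j,
    smooth_on (chart_img c) (fun x => T c x i j);
  tensor_change : forall c c', A c -> A c' -> forall x, overlap c c' x ->
    forall i j, T c x i j =
      \sum_(k < n) \sum_(l < n)
        T c' (c' (chart_inv c x)) k l *
        partial i (transition c c' k) x * partial j (transition c c' l) x
}.

Record riemannian_metric (A : set chart)
    (g : chart -> 'rV[R]_n -> 'M[R]_n) : Prop := {
  metric_tensor : tensor_field A g;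
  metric_sym : forall c, A c -> forall x, chart_img c x -> (g c x)^T = g c x;
  metric_pos : forall c, A c -> forall x, chart_img c x ->
    forall v : 'rV[R]_n, v != 0 -> 0 < (v *m g c x *m v^T) 0 0
}.

End Manifold.

Arguments chart : clear implicits.

(* Levi-Civita connection, curvature and Hessian in one coordinate system, for
   the components G of a metric. *)
Section LocalGeometry.
Context {R : realType} {n : nat}.
Variable G : 'rV[R]_n -> 'M[R]_n.

Definition christoffel (k i j : 'I_n) (x : 'rV[R]_n) : R :=
  2^-1 * \sum_(l < n) invmx (G x) k l *
    (partial i (fun y => G y j l) x + partial j (fun y => G y i l) x
     - partial l (fun y => G y i j) x).

(* R(d_i, d_j) d_k = \sum_l riemann l i j k *: d_l, for
   R(X, Y) Z = D_X D_Y Z - D_Y D_X Z - D_[X, Y] Z *)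
Definition riemann (l i j k : 'I_n) (x : 'rV[R]_n) : R :=
  partial i (christoffel l j k) x - partial j (christoffel l i k) x
  + \sum_(s < n) (christoffel l i s x * christoffel s j k x
                  - christoffel l j s x * christoffel s i k x).

(* Ric(Y, Z) is the trace of X |-> R(X, Y) Z; with these signs, the unit
   sphere of dimension n has Ric = (n - 1) g. *)
Definition ricci (j k : 'I_n) (x : 'rV[R]_n) : R :=
  \sum_(i < n) riemann i i j k x.

Definition hessian (F : 'rV[R]_n -> R) (i j : 'I_n) (x : 'rV[R]_n) : R :=
  partial i (partial j F) x - \sum_(k < n) christoffel k i j x * partial k F x.

End LocalGeometry.

(* The tensor equation D df = (f / m) (Ric - lambda g), componentwise in every
   chart of the atlas. *)
Record closed_generalized_einstein {R : realType} {n : nat}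
    {M : topologicalType} (A : set (chart R n M))
    (g : chart R n M -> 'rV[R]_n -> 'M[R]_n)
    (f lambda : M -> R) (m : R) : Prop := {
  einstein_manifold : closed_manifold A;
  einstein_metric : riemannian_metric A g;
  einstein_smooth : smooth_function A f;
  einstein_lambda_smooth : smooth_function A lambda;
  einstein_m_gt0 : 0 < m;
  einstein_eq : forall c, A c -> forall x, chart_img c x -> forall i j,
    hessian (g c) (f \o chart_inv c) i j x =
    f (chart_inv c x) / m *
      (ricci (g c) i j x - lambda (chart_inv c x) * g c x i j)
}.

Definition is_min {T : Type} {R : realType} (f : T -> R) (a : R) : Prop :=
  range f a /\ lbound (range f) a.

Definition is_max {T : Type} {R : realType} (f : T -> R) (b : R) : Prop :=
  range f b /\ ubound (range f) b.

(* Main.v *)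
Require Import Defs.
From HB Require Import structures.
From mathcomp Require Import all_boot all_order all_algebra.
From mathcomp Require Import ring lra.
From mathcomp Require Import all_classical all_reals all_analysis.
Import Order.TTheory GRing.Theory Num.Theory.
Import numFieldNormedType.Exports.
Set Implicit Arguments.
Unset Strict Implicit.
Unset Printing Implicit Defensive.
Local Open Scope classical_set_scope.
Local Open Scope ring_scope.

(* In a chart, D df = (f / m) (Ric - lambda g) expresses the first partial
   derivatives of the 1-jet (f, df) as linear combinations of its entries, with
   coefficients that are continuous, hence locally bounded. By Gronwall's
   inequality along segments parallel to the coordinate axes, f vanishes near a
   critical zero, and even on a whole neighbourhood of p as soon as its 1-jet
   vanishes at one point of that neighbourhood. The interior of the zero set is
   therefore closed, so by connectedness a critical zero would force f = 0
   everywhere. Moving along the coordinate axes only, and working with the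
   interior of the zero set rather than with the set of critical zeros, avoids
   the multivariate chain rule, and geodesics. *)

(** * Functions of class C^k on an open set *)

Section ClassC.
Context {R : realType} {n : nat} (U : set 'rV[R]_n).
Hypothesis Uopen : open U.
Implicit Types F G : 'rV[R]_n -> R.

Lemma class_C_continuous k F : class_C k U F ->
  forall x, U x -> {for x, continuous F}.
Proof. by case: k => [|k] []. Qed.

Lemma class_CW k F : class_C k.+1 U F -> class_C k U F.
Proof.
elim: k F => [|k IH] F [cF dF]; split=> // i.
by have [dFi /IH] := dF i.
Qed.

Lemma near_eq_open F G : (forall x, U x -> F x = G x) ->
  forall x, U x -> {near x, F =1 G}.
Proof.
move=> FG x Ux; near=> y; apply: FG; near: y; exact: open_nbhs_nbhs.
Unshelve. all: by end_near. Qed.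

(** As [U] is open, derivatives at its points see only values on [U]. Differentiation rules valid
    only on [U] can thus be used in the inductions on [k] below. *)
Lemma class_C_eq k F G : (forall x, U x -> F x = G x) ->
  class_C k U F -> class_C k U G.
Proof.
have cG (H1 H2 : 'rV[R]_n -> R) : (forall x, U x -> H1 x = H2 x) ->
    (forall x, U x -> {for x, continuous H1}) ->
    forall x, U x -> {for x, continuous H2}.
  move=> H12 cH1 x Ux; move: (cH1 _ Ux).
  rewrite /prop_for /continuous_at (H12 _ Ux); apply: cvg_trans.
  apply: (@near_eq_cvg _ _ (nbhs x)).
  by apply: near_eq_open => // y Uy; rewrite H12.
elim: k F G => [|k IH] F G FG [cF dF]; first by split=> //; exact: cG cF.
split=> [|i]; first exact: cG cF.
have [dFi CFi] := dF i; split=> [x Ux|].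
  by apply: near_eq_derivable (dFi x Ux); exact: near_eq_open.
by apply: IH CFi => x Ux; apply: near_eq_derive; exact: near_eq_open.
Qed.

Lemma class_C_cst k (a : R) : class_C k U (fun=> a).
Proof.
elim: k a => [|k IH] a;
  (split; first by move=> x _; exact: cst_continuous) => // i.
split=> [x _|]; first exact: derivable_cst.
by apply: class_C_eq (IH 0) => x _; rewrite /partial derive_cst.
Qed.

Lemma class_CD k F G : class_C k U F -> class_C k U G ->
  class_C k U (fun x => F x + G x).
Proof.
rewrite -[fun x => F x + G x]/(F + G).
elim: k F G => [|k IH] F G [cF dF] [cG dG];
  (split; first by move=> x Ux;
    apply: continuousD; [exact: cF|exact: cG]) => // i.
have [[dFi CF] [dGi CG]] := (dF i, dG i); split=> [x Ux|].
  by apply: derivableD; auto.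
apply: class_C_eq (IH _ _ CF CG) => x Ux.
by rewrite /partial deriveD; auto.
Qed.

Lemma class_CM k F G : class_C k U F -> class_C k U G ->
  class_C k U (fun x => F x * G x).
Proof.
rewrite -[fun x => F x * G x]/(F * G).
elim: k F G => [|k IH] F G CF CG;
  (split; first by move=> x Ux;
    apply: continuousM; [exact: CF.1|exact: CG.1]) => // i.
have [[dFi CFi] [dGi CGi]] := (CF.2 i, CG.2 i); split=> [x Ux|].
  by apply: derivableM; auto.
apply: (@class_C_eq _ (fun x => F x * partial i G x + G x * partial i F x)).
  by move=> x Ux; rewrite /partial deriveM; auto.
by apply: class_CD; apply: IH => //; exact: class_CW.
Qed.

Lemma class_CV k F : (forall x, U x -> F x != 0) -> class_C k U F ->
  class_C k U (fun x => (F x)^-1).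
Proof.
move=> F0; elim: k F F0 => [|k IH] F F0 CF;
  (split; first by move=> x Ux;
    apply: continuousV; [exact: F0|exact: CF.1]) => // i.
have [dFi CFi] := CF.2 i; split=> [x Ux|].
  by apply: derivableV; auto.
have CV := IH _ F0 (class_CW CF).
(* Written as a product, the derivative of [1 / F] involves [1 / F] itself only at order [k], where
   the induction hypothesis applies. *)
apply: (@class_C_eq _ (fun x => -1 * (F x)^-1 * (F x)^-1 * partial i F x)).
  move=> x Ux; rewrite /partial deriveV; [|exact: F0|exact: dFi].
  by rewrite expr2 invfM mulN1r !mulNr scaleNr.
by do 3![apply: class_CM => //]; exact: class_C_cst.
Qed.

Lemma class_C_sum k (I : Type) (r : seq I) (P : pred I)
    (F : I -> 'rV[R]_n -> R) :
  (forall i, P i -> class_C k U (F i)) ->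
  class_C k U (fun x => \sum_(i <- r | P i) F i x).
Proof.
move=> CF; rewrite -fct_sumE.
by elim/big_ind: _ => //; [exact: class_C_cst|exact: class_CD].
Qed.

Lemma class_C_prod k (I : Type) (r : seq I) (P : pred I)
    (F : I -> 'rV[R]_n -> R) :
  (forall i, P i -> class_C k U (F i)) ->
  class_C k U (fun x => \prod_(i <- r | P i) F i x).
Proof.
move=> CF; rewrite -fct_prodE.
by elim/big_ind: _ => //; [exact: class_C_cst|exact: class_CM].
Qed.

Lemma class_CB k F G : class_C k U F -> class_C k U G ->
  class_C k U (fun x => F x - G x).
Proof.
move=> CF CG.
apply: class_C_eq (class_CD CF (class_CM (class_C_cst k (-1)) CG)).
by move=> x _; rewrite mulN1r.
Qed.

Lemma class_C_partial k i F : class_C k.+1 U F -> class_C k U (partial i F).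
Proof. by case=> _ /(_ i)[]. Qed.

End ClassC.

(** * Gronwall's inequality and vanishing on a box *)

(** The energy [E], the sum of the squares, satisfies [E' <= C E]; hence [E exp(-C t)] is
    nonincreasing, starts at 0 and is nonnegative. *)
Lemma gronwall_eq0 (R : realType) (N : nat) (u : 'I_N -> R -> R) (K : R) :
  (forall j t, 0 <= t <= 1 -> derivable (u j) t 1) ->
  (forall j t, 0 <= t <= 1 -> `|'D_1 (u j) t| <= K * \sum_(l < N) `|u l t|) ->
  (forall j, u j 0 = 0) ->
  forall j, u j 1 = 0.
Proof.
move=> du bu u0 j0.
pose C : R := 2 * `|K| * N%:R.
pose E : R -> R := \sum_(j < N) u j * u j.
pose h : R -> R := E * (expR \o *%R (- C)).
have EE t : E t = \sum_(j < N) u j t ^+ 2.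
  by rewrite /E fct_sumE; apply: eq_bigr => j _; rewrite expr2.
have dh (t : R) : 0 <= t <= 1 -> is_derive t 1 h
    (E t * (expR (- C * t) * - C) + expR (- C * t) *
       \sum_(j < N) (u j t * 'D_1 (u j) t + u j t * 'D_1 (u j) t)).
  move=> t01; apply: is_deriveM.
    apply: is_derive_sum => j.
    by apply: is_deriveM; apply: derivableP; exact: du.
  apply: is_derive1_comp.
  have -> : *%R (- C) = (- C) \*: (id : R -> R) by [].
  by apply: is_derive_eq; rewrite /GRing.scale/= mulr1.
have h_le0 (t : R) : 0 <= t <= 1 -> 'D_1 h t <= 0.
  move=> t01; rewrite (@derive_val _ _ _ _ _ _ _ (dh _ t01)).
  (* Factoring out the exponential leaves [E' <= C E]. Each product [2 |u j| |u l|] is at most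
     [u j ^+ 2 + u l ^+ 2]; the double sum of these is [2 N E], whence the value of [C]. *)
  rewrite mulrCA -mulrDr pmulr_rle0 ?expR_gt0// mulrN addrC subr_le0.
  apply: (@le_trans _ _ (\sum_(j < N) \sum_(l < N)
      `|K| * (u j t ^+ 2 + u l t ^+ 2))).
    apply: ler_sum => j _.
    apply: le_trans (ler_norm _) _.
    rewrite -mulr2n normrMn normrM.
    apply: (@le_trans _ _ (`|u j t| * (`|K| * \sum_(l < N) `|u l t|) *+ 2)).
      rewrite lerMn2r/= ler_wpM2l// (le_trans (bu _ _ t01))//.
      rewrite ler_wpM2r ?ler_norm//.
      exact: sumr_ge0.
    rewrite -mulr_sumr mulrCA -mulrnAr ler_wpM2l// mulr_sumr -sumrMnl.
    apply: ler_sum => l _.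
    rewrite -[X in _ <= X + _]real_normK ?num_real//.
    rewrite -[X in _ <= _ + X]real_normK ?num_real//.
    by have := sqr_ge0 (`|u j t| - `|u l t|); rewrite sqrrB; lra.
  under eq_bigr => j _.
    rewrite -mulr_sumr big_split/= sumr_const card_ord -(EE t); over.
  rewrite -mulr_sumr big_split/= sumr_const card_ord sumrMnl -(EE t).
  rewrite -[E t *+ N]mulr_natr /C.
  by rewrite !(mulrDr, mulrDl); lra.

have : h 1 <= h 0.
  apply: (@ler0_derive1_nincr _ h 0 1) => //.
  - move=> t /[!in_itv]/= /andP[t0 t1].
    by apply: ex_derive; apply: dh; rewrite !ltW.
  - by move=> t /[!in_itv]/= /andP[t0 t1]; rewrite derive1E h_le0// !ltW.
  - apply: derivable_within_continuous => t /[!in_itv]/= t01.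
    by apply: ex_derive; exact: dh.
rewrite /h /GRing.mul/= -/GRing.mul.
have -> : E 0 = 0 by rewrite EE big1// => j _; rewrite u0 expr0n.
rewrite mul0r pmulr_lle0 ?expR_gt0// EE => E1.
have /eqP : \sum_(j < N) u j 1 ^+ 2 = 0.
  by apply/eqP; rewrite eq_le E1 sumr_ge0// => j _; exact: sqr_ge0.
rewrite psumr_eq0; last by move=> j _; exact: sqr_ge0.
by move=> /allP/(_ j0 (mem_index_enum _)); rewrite sqrf_eq0 => /eqP.
Qed.

Lemma is_derive_line (R : realType) (V : normedModType R) (F : V -> R)
    (x v : V) (s : R) : derivable F (s *: v + x) v ->
  is_derive s 1 (fun t : R => F (t *: v + x)) ('D_v F (s *: v + x)).
Proof.
move=> dF.
have E : (fun h : R => h^-1 *: (((fun t : R => F (t *: v + x)) \o shift s)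
      (h *: 1) - F (s *: v + x))) =
    (fun h => h^-1 *: ((F \o shift (s *: v + x)) (h *: v) - F (s *: v + x))).
  by apply/funext => h /=; rewrite [h *: 1]mulr1 scalerDl addrA.
by split; rewrite ?/derivable /derive E.
Qed.

Section Box.
Context {R : realType} {n N : nat} (u : 'I_N -> 'rV[R]_n -> R).
Context (x0 : 'rV[R]_n) (r K : R).
Hypothesis du : forall x, ball x0 r x -> forall i j,
  derivable (u j) x (delta_mx 0 i).
Hypothesis bu : forall x, ball x0 r x -> forall i j,
  `|partial i (u j) x| <= K * \sum_(l < N) `|u l x|.

(** The segment is parametrized by [[0, 1]], so the chain rule in one variable brings a factor [d],
    and Gronwall applies with constant [|d| * K]. *)
Lemma vanish_line x i (d : R) :
  (forall t, 0 <= t <= 1 -> ball x0 r ((t * d) *: delta_mx 0 i + x)) ->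
  (forall j, u j x = 0) -> forall j, u j (d *: delta_mx 0 i + x) = 0.
Proof.
move=> Bx ux.
have dw j (t : R) : 0 <= t <= 1 ->
    is_derive t 1 (fun t : R => u j ((t * d) *: delta_mx 0 i + x))
      (partial i (u j) ((t * d) *: delta_mx 0 i + x) * d).
  move=> t01.
  apply: (@is_derive1_comp _ (fun s : R => u j (s *: delta_mx 0 i + x))
                             (fun t : R => t * d)).
    by apply: is_derive_line; exact: du (Bx _ t01) _ _.
  have -> : (fun t : R => t * d) = d \*: (id : R -> R).
    by apply/funext => s; rewrite mulrC.
  by apply: is_derive_eq; rewrite /GRing.scale/= mulr1.
move=> j; have := @gronwall_eq0 R N
  (fun j (t : R) => u j ((t * d) *: delta_mx 0 i + x)) (`|d| * K).
move=> /(_ _ _ _ j); rewrite mul1r; apply.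
- by move=> l t t01; apply: ex_derive; exact: dw.
- move=> l t t01; rewrite (@derive_val _ _ _ _ _ _ _ (dw l t t01)).
  rewrite normrM mulrC -mulrA ler_wpM2l//; exact: bu (Bx _ t01) _ _.
- by move=> l; rewrite mul0r scale0r add0r.
Qed.

(* A ball of the sup norm is a box, so its points are joined by paths inside it
   that change one coordinate at a time. *)
Lemma vanish_ball x1 : ball x0 r x1 -> (forall j, u j x1 = 0) ->
  forall x, ball x0 r x -> forall j, u j x = 0.
Proof.
move=> [r0 Bx1] ux1 x [_ Bx].
(* Corners of the path: [y 0] is [x1], [y n] is [x], and [y k.+1] differs from [y k] at most in
   coordinate [k]. *)
pose y k : 'rV[R]_n := \row_j (if (j < k)%N then x 0 j else x1 0 j).
suff uy k : (k <= n)%N -> forall j, u j (y k) = 0.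
  suff <- : y n = x by exact: uy.
  by apply/rowP => j; rewrite mxE ltn_ord.
elim: k => [_|k IH kn].
  suff -> : y 0%N = x1 by [].
  by apply/rowP => j; rewrite mxE.
pose i := Ordinal kn.
have -> : y k.+1 = (x 0 i - x1 0 i) *: delta_mx 0 i + y k.
  apply/rowP => j; rewrite !mxE eqxx/= ltnS leq_eqVlt.
  have [->|ji] := eqVneq j i; first by rewrite eqxx/= ltnn mulr1 subrK.
  by rewrite mulr0 add0r (_ : (j == k :> nat) = false)//; exact/negbTE.
apply: vanish_line; last by apply: IH; exact: ltnW.
move=> t /andP[t0 t1]; split=> // a j; rewrite !mxE ord1 eqxx/=.
have [->|ji] := eqVneq j i; last first.
  by rewrite mulr0 add0r; case: ifP => _; [exact: Bx|exact: Bx1].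
rewrite ltnn mulr1; move: (Bx 0 i) (Bx1 0 i); rewrite /ball/= !ltr_norml.
move=> /andP[a1 a2] /andP[b1 b2].
(* The moving coordinate stays between [x1 0 i] and [x 0 i], both within [r] of the centre; the two
   cases are the directions of motion. *)
have [x1x|xx1] := leP (x1 0 i) (x 0 i).
  have : 0 <= t * (x 0 i - x1 0 i) <= x 0 i - x1 0 i by apply/andP; split; nra.
  by move=> /andP[c1 c2]; apply/andP; split; lra.
have : x 0 i - x1 0 i <= t * (x 0 i - x1 0 i) <= 0 by apply/andP; split; nra.
by move=> /andP[c1 c2]; apply/andP; split; lra.
Qed.

End Box.

(** * Unique continuation from a vanishing 1-jet *)

Section JetUniqueness.
Context {R : realType} {n : nat} (U : set 'rV[R]_n).
Hypothesis Uopen : open U.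
Context (F : 'rV[R]_n -> R).
Context (a : 'I_n -> 'I_n -> 'I_n -> 'rV[R]_n -> R).
Context (b : 'I_n -> 'I_n -> 'rV[R]_n -> R).
Hypothesis CF : class_C 2 U F.
Hypothesis Ca : forall i j k, class_C 0 U (a i j k).
Hypothesis Cb : forall i j, class_C 0 U (b i j).
Hypothesis hess : forall x, U x -> forall i j, partial i (partial j F) x =
  \sum_(k < n) a i j k x * partial k F x + b i j x * F x.

Let jet (j : 'I_n.+1) : 'rV[R]_n -> R :=
  if unlift ord0 j is Some k then partial k F else F.

(** A continuous bound for all coefficients at once. The 1 accounts for the derivatives of [F],
    which are themselves entries of the jet. *)
Let S (x : 'rV[R]_n) : R := 1 +
  (\sum_(q : 'I_n * 'I_n * 'I_n) `|a q.1.1 q.1.2 q.2 x| +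
   \sum_(q : 'I_n * 'I_n) `|b q.1 q.2 x|).

Let sum_jet x :
  \sum_(l < n.+1) `|jet l x| = `|F x| + \sum_(k < n) `|partial k F x|.
Proof.
rewrite big_ord_recl /jet unlift_none; congr (_ + _).
by apply: eq_bigr => k _; rewrite liftK.
Qed.

Let jet_bound x : U x -> forall i j,
  `|partial i (jet j) x| <= S x * \sum_(l < n.+1) `|jet l x|.
Proof.
move=> Ux i j; rewrite sum_jet.
have a0 : 0 <= \sum_(q : 'I_n * 'I_n * 'I_n) `|a q.1.1 q.1.2 q.2 x|.
  exact: sumr_ge0.
have b0 : 0 <= \sum_(q : 'I_n * 'I_n) `|b q.1 q.2 x| by exact: sumr_ge0.
have S1 : 1 <= S x by rewrite /S lerDl addr_ge0.
rewrite /jet; case: unliftP => [k _|_]; last first.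
  apply: (@le_trans _ _ (`|F x| + \sum_(k < n) `|partial k F x|)).
    rewrite (bigD1 i)//= addrCA lerDl addr_ge0// sumr_ge0//.
  by rewrite ler_peMl// addr_ge0// sumr_ge0.
rewrite hess// mulrDr addrC (le_trans (ler_normD _ _))// lerD//.
  rewrite normrM ler_wpM2r//.
  suff : `|b i k x| <= \sum_(q : 'I_n * 'I_n) `|b q.1 q.2 x| by rewrite /S; lra.
  by rewrite (bigD1 (i, k))//= lerDl sumr_ge0.
rewrite mulr_sumr (le_trans (ler_norm_sum _ _ _))// ler_sum// => l _.
rewrite normrM ler_wpM2r//.
suff : `|a i k l x| <= \sum_(q : 'I_n * 'I_n * 'I_n) `|a q.1.1 q.1.2 q.2 x|.
  by rewrite /S; lra.
by rewrite (bigD1 (i, k, l))//= lerDl sumr_ge0.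
Qed.

Let S_continuous x : U x -> {for x, continuous S}.
Proof.
have Cnorm H : class_C 0 U H -> class_C 0 U (fun x => `|H x|).
  by case=> cH _; split=> // y Uy; exact: cvg_norm (cH y Uy).
apply: (@class_C_continuous _ _ _ 0).
apply: class_CD => //; first exact: class_C_cst.
by apply: class_CD => //; apply: class_C_sum => // q _; exact: Cnorm.
Qed.

(** The radius is chosen before [x1]: this uniformity is what later makes the interior of the zero
    set closed. *)
Lemma jet_unique x0 : U x0 -> exists2 r, 0 < r & ball x0 r `<=` U /\
  forall x1, ball x0 r x1 -> F x1 = 0 -> (forall k, partial k F x1 = 0) ->
  forall x, ball x0 r x -> F x = 0.
Proof.
move=> Ux0.
(* Continuity of [S] yields one Gronwall constant, [S x0 + 1], for a whole ball. *)
have : \forall x \near x0, U x /\ S x < S x0 + 1.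
  near=> x; split; near: x; first exact: open_nbhs_nbhs.
  by apply: cvgr_lt (S_continuous Ux0) _ _; rewrite ltrDl.
move=> /nbhs_ballP[r /= r0 Br].
exists r => //; split=> [x /Br[]//|x1 Bx1 F0 dF0 x Bx].
have -> : F = jet ord0 by rewrite /jet unlift_none.
apply: (@vanish_ball _ _ _ jet x0 r (S x0 + 1) _ _ x1) => //.
- move=> y /Br[Uy _] i j; rewrite /jet; case: unliftP => [k _|_].
    exact: ((CF.2 k).2.2 i).1.
  exact: (CF.2 i).1.
- move=> y /Br[Uy Sy] i j; apply: (le_trans (jet_bound Uy i j)).
  by rewrite ler_wpM2r ?sumr_ge0// ltW.
- by move=> j; rewrite /jet; case: unliftP.
Unshelve. all: by end_near. Qed.

End JetUniqueness.

(** * Regularity of the inverse metric and the curvature *)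

Section MetricRegularity.
Context {R : realType} {n : nat} (U : set 'rV[R]_n).
Hypothesis Uopen : open U.

(** By the Leibniz formula. The size [p] is free so that the minors in the cofactors are covered
    too. *)
Lemma class_C_det k p (H : 'rV[R]_n -> 'M[R]_p) :
  (forall i j, class_C k U (fun x => H x i j)) ->
  class_C k U (fun x => \det (H x)).
Proof.
move=> CH; apply: class_C_sum => // s _.
apply: class_CM => //; first exact: class_C_cst.
by apply: class_C_prod => // i _; exact: CH.
Qed.

Context (G : 'rV[R]_n -> 'M[R]_n).
Hypothesis CG : forall k i j, class_C k U (fun x => G x i j).
Hypothesis G_unit : forall x, U x -> G x \in unitmx.

(** Cramer's rule, valid on [U], where the determinant does not vanish. *)
Lemma class_C_invmx k i j : class_C k U (fun x => invmx (G x) i j).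
Proof.
apply: (@class_C_eq _ _ _ Uopen _
    (fun x => (\det (G x))^-1 * cofactor (G x) j i)).
  by move=> x Ux; rewrite /invmx G_unit// !mxE.
apply: class_CM => //.
  apply: class_CV => //; last exact: class_C_det.
  by move=> x /G_unit; rewrite unitmxE unitfE.
apply: class_CM => //; first exact: class_C_cst.
apply: class_C_det => a b.
by apply: class_C_eq (CG k (lift j a) (lift i b)) => // x _; rewrite !mxE.
Qed.

Lemma class_C_christoffel k l i j : class_C k U (christoffel G l i j).
Proof.
apply: class_CM => //; first exact: class_C_cst.
apply: class_C_sum => // s _; apply: class_CM => //; first exact: class_C_invmx.
apply: class_CB => //; first apply: class_CD => //;
  by apply: class_C_partial; exact: CG.
Qed.

Lemma class_C_ricci k i j : class_C k U (ricci G i j).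
Proof.
apply: class_C_sum => // s _; apply: class_CD => //.
  by apply: class_CB => //; apply: class_C_partial; exact: class_C_christoffel.
apply: class_C_sum => // t _.
by apply: class_CB => //; apply: class_CM => //; exact: class_C_christoffel.
Qed.

End MetricRegularity.

(** A nonzero vector in the kernel of a singular [G] would make the form vanish. *)
Lemma pos_form_unitmx (R : realType) (n : nat) (G : 'M[R]_n) :
  (forall v : 'rV[R]_n, v != 0 -> 0 < (v *m G *m v^T) 0 0) -> G \in unitmx.
Proof.
move=> Gpos; rewrite unitmxE unitfE; apply/negP => /det0P[v v0 vG].
by have := Gpos v v0; rewrite vG mul0mx mxE ltxx.
Qed.

(** * The zero set of [f] on the manifold *)

Section Einstein.
Context {R : realType} {n : nat} {M : topologicalType}.
Context (A : set (chart R n M)) (g : chart R n M -> 'rV[R]_n -> 'M[R]_n).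
Context (f lambda : M -> R) (m : R).
Hypothesis hM : closed_generalized_einstein A g f lambda m.

Lemma einstein_jet_unique c p : A c -> chart_dom c p ->
  exists2 W, nbhs p W & forall q, W q -> f q = 0 ->
    (forall k, partial k (f \o chart_inv c) (c q) = 0) ->
    forall q', W q' -> f q' = 0.
Proof.
move=> Ac cp; pose U := chart_img c; pose F := f \o chart_inv c.
have Uopen : open U := @chart_img_open _ _ _ c.
have Up : U (c p) by exists p.
have [gT _ gpos] := einstein_metric hM.
have Cg k i j : class_C k U (fun x => g c x i j).
  by exact: tensor_smooth gT _ Ac _ _ _.
have gU x : U x -> g c x \in unitmx.
  by move=> Ux; apply: pos_form_unitmx => v; exact: gpos.
have CF k : class_C k U F by exact: einstein_smooth hM _ Ac _.
have Cl k : class_C k U (lambda \o chart_inv c).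
  by exact: einstein_lambda_smooth hM _ Ac _.
have [r r0 [BU Br]] : exists2 r, 0 < r & ball (c p) r `<=` U /\
    forall x1, ball (c p) r x1 -> F x1 = 0 -> (forall k, partial k F x1 = 0) ->
    forall x, ball (c p) r x -> F x = 0.
  (* The Einstein equation solved for the second partials: Christoffel symbols multiply [df], and
     [(Ric - lambda g) / m] multiplies [f]. *)
  apply: (@jet_unique _ _ U Uopen F (fun i j k => christoffel (g c) k i j)
    (fun i j x => m^-1 * (ricci (g c) i j x -
                          lambda (chart_inv c x) * g c x i j))) => //.
  - by move=> i j k; exact: class_C_christoffel.
  - move=> i j; apply: class_CM => //; first exact: class_C_cst.
    apply: class_CB => //; first exact: class_C_ricci.
    by apply: class_CM => //; exact: Cl.
  - move=> x Ux i j; have := einstein_eq hM Ac Ux i j.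
    rewrite /hessian => /eqP; rewrite subr_eq => /eqP ->; rewrite addrC.
    by congr (_ + _); rewrite -[RHS]mulrC mulrA.
have FK q : chart_dom c q -> F (c q) = f q.
  by move=> cq; rewrite /F/= chartK.
exists (chart_dom c `&` c @^-1` ball (c p) r).
  apply: filterI; last first.
    by apply: (chart_cont cp); exact: nbhsx_ballx.
  by apply: open_nbhs_nbhs; split => //; exact: chart_dom_open.
move=> q [cq Bq] fq0 dFq0 q' [cq' Bq'].
by rewrite -FK//; apply: Br Bq _ _ _ Bq' => //; rewrite FK.
Qed.

(** Vanishing near a point is independent of charts, so it passes from one chart to another without
    transforming derivatives. *)
Lemma locally_zero_jet (c : chart R n M) q :
  chart_dom c q -> (\forall q' \near q, f q' = 0) ->
  forall k, partial k (f \o chart_inv c) (c q) = 0.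
Proof.
move=> cq f0 k; rewrite /partial.
rewrite (@near_eq_derive _ _ _ _ (cst 0)) ?derive_cst//.
have cU : (c @` chart_dom c) (c q) by exists q.
have : chart_inv c @ c q --> chart_inv c (c q) := chart_inv_cont cU.
by rewrite chartK// => /(_ _ f0).
Qed.

Lemma critical_zero_eq0 p : f p = 0 -> critical_point A f p ->
  forall q, f q = 0.
Proof.
move=> fp0 [c [Ac cp dF0]].
have [[manifoldM _ connM] _ _ _ _ _] := hM.
pose Z := interior [set q | f q = 0].
suff ZT : Z = setT.
  by move=> q; have : Z q by [rewrite ZT]; exact: interior_subset.
apply: connM.
(* [Z] is nonempty: [f] vanishes near the critical zero [p]. *)
- have [W Wp fW] := einstein_jet_unique Ac cp.
  exists p; apply: filterS (Wp) => q Wq.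
  by apply: (fW p) => //; exact: nbhs_singleton Wp.
- by exists Z; [exact: open_interior|rewrite setTI].
(* [Z] is closed: the uniqueness neighbourhood [W] of a closure point [q] meets [Z] at some [q1],
   whose 1-jet is zero, so [f] vanishes on [W] and [q] is in [Z]. *)
exists Z; rewrite ?setTI// => q clZq.
have [c' Ac' c'q] := atlas_cover manifoldM q.
have [W Wq fW] := einstein_jet_unique Ac' c'q.
have c'nb : nbhs q (chart_dom c').
  by apply: open_nbhs_nbhs; split => //; exact: chart_dom_open.
have [q1 [Zq1 [Wq1 c'q1]]] := clZq _ (filterI Wq c'nb).
apply: filterS Wq => q2; apply: (fW q1) => //.
  exact: interior_subset Zq1.
exact: locally_zero_jet.
Qed.

(** Smoothness is stated in charts only; near [p], [f] is its chart expression composed with the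
    chart. *)
Lemma einstein_continuous : continuous f.
Proof.
move=> p.
have [c Ac cp] := atlas_cover (closed_smooth (einstein_manifold hM)) p.
have cU : chart_img c (c p) by exists p.
have cF := class_C_continuous (einstein_smooth hM Ac 0) cU.
have cfc : {for p, continuous ((f \o chart_inv c) \o c)}.
  by apply: continuous_comp cF; exact: chart_cont.
have : f \o chart_inv c \o c @ p --> f (chart_inv c (c p)) := cfc.
rewrite chartK//.
apply: cvg_trans; apply: near_eq_cvg.
have cnb : nbhs p (chart_dom c).
  by apply: open_nbhs_nbhs; split => //; exact: chart_dom_open.
by apply: filterS cnb => q cq; rewrite /= chartK.
Qed.

End Einstein.

Theorem lemma2p2 (R : realType) (n : nat) (M : topologicalType)
    (A : set (chart R n M)) (g : chart R n M -> 'rV[R]_n -> 'M[R]_n)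
    (f lambda : M -> R) (m : R)
    (hM : closed_generalized_einstein A g f lambda m)
    (fmin fmax : R) (hmin : is_min f fmin) (hmax : is_max f fmax)
    (hmin0 : fmin < 0) (hmax0 : 0 < fmax) :
  (f @^-1` [set 0]) !=set0 /\
  forall p : M, (f @^-1` [set 0]) p -> ~ critical_point A f p.
Proof.
split; last first.
  move=> p fp0 critp; have [[q _ fq] _] := hmax.
  by move: hmax0; rewrite -fq (critical_zero_eq0 hM fp0 critp) ltxx.
(* Intermediate values: the range is connected, hence an interval, and 0 lies between [fmin] and
   [fmax]. *)
have connf : connected (range f).
  apply: connected_continuous_connected.
    exact: closed_connected (einstein_manifold hM).
  by apply: continuous_subspaceT; exact: einstein_continuous hM.
have /connected_intervalP := connf.
move=> /(_ _ _ hmin.1 hmax.1 0)[|p _ fp0]; first by rewrite !ltW.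
by exists p.
Qed.
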